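(* Properties (P2) and (P3) are different; that is, there exists an infinite-dimensional real Banach space which has property (P3) but does not have property (P2).
   Context: For a Banach space $Z$ with closed unit ball $B_Z$, unit sphere $S_Z$, dual $Z^\ast$ and dual unit sphere $S_{Z^\ast}$, a slice of $B_Z$ is a set of the form $S(z^\ast,\alpha)=\{z\in B_Z\colon z^\ast(z)>1-\alpha\}$ with $z^\ast\in S_{Z^\ast}$ and $\alpha>0$. A convex combination of slices of $B_Z$ is a set of the form $\sum_{i=1}^n\lambda_iS_i=\{\sum_{i=1}^n\lambda_i s_i\colon s_i\in S_i\}$, where $n\in\mathbb{N}$, $\lambda_1,\dotsc,\lambda_n\geq 0$, $\sum_{i=1}^n\lambda_i=1$, and $S_1,\dotsc,S_n$ are slices of $B_Z$. Property (P2) of $Z$: every convex combination of slices of $B_Z$ has nonempty interior in the relative weak topology of $B_Z$. Property (P3) of $Z$: every convex combination of slices of $B_Z$ intersects the unit sphere $S_Z$. For infinite-dimensional spaces, property (P2) implies property (P3). *)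

(* Defs.v *)
From mathcomp Require Import all_boot all_order all_algebra.
From mathcomp Require Import all_classical all_reals all_analysis.

Unset Implicit Arguments.

Import Order.TTheory GRing.Theory Num.Theory.
Import numFieldNormedType.Exports.

Local Open Scope classical_set_scope.
Local Open Scope ring_scope.

Definition infinite_dimensional {R : realType}
    (Z : completeNormedModType R) : Prop :=
  forall (n : nat) (v : 'I_n -> Z),
    exists z : Z, forall a : 'I_n -> R, z <> \sum_(i < n) a i *: v i.

Definition unit_ball {R : realType} (Z : completeNormedModType R) : set Z :=
  [set z | `|z| <= 1].

Definition unit_sphere {R : realType} (Z : completeNormedModType R) : set Z :=
  [set z | `|z| = 1].

Definition dual {R : realType} (Z : completeNormedModType R) : Type :=
  {f : {linear Z -> R^o} | continuous f}.

Definition dual_norm {R : realType} {Z : completeNormedModType R}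
    (f : dual Z) : R :=
  sup [set `|sval f z| | z in unit_ball Z].

Definition dual_unit_sphere {R : realType} (Z : completeNormedModType R) :
    set (dual Z) :=
  [set f | dual_norm f = 1].

(* The initial topology on Z of the family of all elements of the dual. *)
Definition weak {R : realType} (Z : completeNormedModType R) :
    topologicalType :=
  @sup_topology Z (dual Z)
    (fun f => Topological.on (initial_topology (sval f : Z -> R^o))).

Definition slice {R : realType} {Z : completeNormedModType R}
    (f : dual Z) (alpha : R) : set Z :=
  [set z | unit_ball Z z /\ sval f z > 1 - alpha].

Definition is_slice {R : realType} {Z : completeNormedModType R}
    (S : set Z) : Prop :=
  exists (f : dual Z) (alpha : R),
    [/\ dual_unit_sphere Z f, 0 < alpha & S = slice f alpha].

Definition is_convex_combination_of_slices {R : realType}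
    {Z : completeNormedModType R} (C : set Z) : Prop :=
  exists (n : nat) (lambda : 'I_n -> R) (S : 'I_n -> set Z),
    [/\ forall i, 0 <= lambda i,
        \sum_(i < n) lambda i = 1,
        forall i, is_slice (S i) &
        C = [set \sum_(i < n) lambda i *: s i
            | s in [set s : 'I_n -> Z | forall i, S i (s i)]]].

(* The unit ball as a space on its own, with the topology induced by the weak
   topology of Z. *)
Definition weak_unit_ball {R : realType} (Z : completeNormedModType R) :
    topologicalType :=
  set_type (unit_ball Z : set (weak Z)).

Definition P2 {R : realType} (Z : completeNormedModType R) : Prop :=
  forall C : set Z, is_convex_combination_of_slices C ->
    interior (set_val @^-1` C : set (weak_unit_ball Z)) !=set0.

Definition P3 {R : realType} (Z : completeNormedModType R) : Prop :=
  forall C : set Z, is_convex_combination_of_slices C ->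
    C `&` unit_sphere Z !=set0.

(* Main.v *)
(* The space is Z = l^oo (+)_oo (R (+)_1 l^oo).  In either copy of l^oo the unit
   vectors e_n are weakly null, since sum_n |f(e_n)| <= |f|.
   Property (P3): given points s_i of finitely many slices, replace the n-th
   entry in the first l^oo of every s_i by 1.  For n large this stays inside the
   slices, and then any convex combination has n-th entry 1, hence norm 1.
   Failure of (P2): a point of the ball with R-coordinate r has all entries in
   the second l^oo at most 1 - |r|.  So these are below 1/8 on the slice given by
   the R-coordinate and alpha = 1/8, and at every point z of the average C of
   this slice and its opposite, where moreover |r| is at most 1/8.  But
   z + e_n / 2, with e_n from the second l^oo, is in the unit ball, tends weakly
   to z and has an entry at least 3/8, so C has empty relative weak interior. *)
Require Import Defs.
From HB Require Import structures.
From mathcomp Require Import all_boot all_order all_algebra.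
From mathcomp Require Import all_classical all_reals all_analysis.
From mathcomp Require Import ring lra.

Import Order.TTheory GRing.Theory Num.Theory.
Import numFieldNormedType.Exports.

Local Open Scope classical_set_scope.
Local Open Scope ring_scope.

(** * The space, its norm and its completeness *)

Section Space.
Context {R : realType}.

(* [None] is the R-coordinate, [Some (false, n)] and [Some (true, n)] are the
   entries in the first and the second copy of l^oo. *)
Definition label : Type := option (bool * nat).

(** The flag [k.1], read as 0 or 1, lets one supremum over [k] give the whole norm: on the second
    copy, sup_n (|x_n| + |r|) = |r| + sup_n |x_n| is the l^1-sum norm. *)
Definition block (k : bool * nat) (x : label -> R^o) : R :=
  `|x (Some k)| + k.1%:R * `|x None|.

Lemma block_ge0 k x : 0 <= block k x.
Proof. by rewrite addr_ge0// mulr_ge0. Qed.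

Lemma ler_blockD k x y : block k (x + y) <= block k x + block k y.
Proof.
rewrite /block addrACA -mulrDr lerD ?ler_normD// ler_wpM2l//; exact: ler_normD.
Qed.

Lemma blockZ k a x : block k (a *: x) = `|a| * block k x.
Proof. by rewrite /block mulrDr mulrCA -!normrM. Qed.

Definition bounded_blocks : {pred label -> R^o} :=
  [pred x | `[< has_ubound (range (block^~ x)) >]].

Lemma bounded_blocksP x :
  x \in bounded_blocks <-> exists M, forall k, block k x <= M.
Proof.
split=> [/asboolP[M xM]|[M xM]].
  by exists M => k; apply: xM; exists k.
by apply/asboolP; exists M => _ [k _ <-].
Qed.

Lemma bounded_blocks_submod : submod_closed bounded_blocks.
Proof.
split=> [|a x y /bounded_blocksP[M xM] /bounded_blocksP[N yN]].
  by apply/bounded_blocksP; exists 0 => k; rewrite /block !normr0 mulr0 addr0.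
apply/bounded_blocksP; exists (`|a| * M + N) => k.
by rewrite (le_trans (ler_blockD _ _ _))// blockZ lerD// ler_wpM2l.
Qed.

HB.instance Definition _ :=
  GRing.isSubmodClosed.Build R (label -> R^o) bounded_blocks
    bounded_blocks_submod.

Record blockSpace : Type := BlockSpace {
  entry :> label -> R^o;
  entry_bounded : entry \in bounded_blocks
}.

HB.instance Definition _ := [isSub for entry].
HB.instance Definition _ := [Choice of blockSpace by <:].
HB.instance Definition _ := [SubChoice_isSubLmodule of blockSpace by <:].

Definition space_norm (x : blockSpace) : R := sup (range (block^~ x)).

Lemma block_le_space_norm k (x : blockSpace) : block k x <= space_norm x.
Proof. by apply: ub_le_sup; [exact/asboolP/entry_bounded|exists k]. Qed.

Lemma space_norm_leP (x : blockSpace) M :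
  space_norm x <= M <-> forall k, block k x <= M.
Proof.
split=> [xM k|xM]; first exact: le_trans (block_le_space_norm k x) xM.
apply: ge_sup; first by exists (block (true, 0) x), (true, 0).
by move=> _ [k _ <-].
Qed.

Lemma ler_space_normD x y : space_norm (x + y) <= space_norm x + space_norm y.
Proof.
apply/space_norm_leP => k; apply: le_trans (ler_blockD _ _ _) _.
by rewrite lerD// block_le_space_norm.
Qed.

Lemma space_normZ a x : space_norm (a *: x) = `|a| * space_norm x.
Proof.
have le_normZ b y : space_norm (b *: y) <= `|b| * space_norm y.
  by apply/space_norm_leP => k; rewrite blockZ ler_wpM2l ?block_le_space_norm.
apply/eqP; rewrite eq_le le_normZ/=.
have [->|a0] := eqVneq a 0.
  rewrite normr0 mul0r; apply: le_trans (block_ge0 (true, 0) _) _.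
  exact: block_le_space_norm.
(* The reverse inequality is [le_normZ] for the scalar [a^-1] and the vector [a *: x]. *)
rewrite mulrC -ler_pdivlMr ?normr_gt0// mulrC -normfV.
by rewrite -{1}[x](scalerK a0) le_normZ.
Qed.

Lemma entry_le_space_norm i (x : blockSpace) : `|x i| <= space_norm x.
Proof.
case: i => [k|].
  by apply: le_trans (block_le_space_norm k x); rewrite lerDl mulr_ge0.
apply: le_trans (block_le_space_norm (true, 0) x).
by rewrite /block mul1r lerDr.
Qed.

Lemma space_norm0_eq0 x : space_norm x = 0 -> x = 0.
Proof.
move=> x0; apply/val_inj/funext => i /=; apply/eqP.
by rewrite -normr_le0 -x0 entry_le_space_norm.
Qed.

HB.instance Definition _ :=
  Lmodule_isNormed.Build R blockSpace
    ler_space_normD space_normZ space_norm0_eq0.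

(** The limit [l] is taken entry by entry. A block involves only two entries, so the auxiliary point
    [y] may depend on [k] while the bound [e] does not; hence the convergence is uniform in [k]. *)
Lemma space_complete (F : set_system blockSpace) :
  ProperFilter F -> cauchy F -> cvg F.
Proof.
move=> FF /cauchy_ballP Fc.
have entry_cvg i : cvg ((fun x : blockSpace => x i : R) @ F).
  apply/cauchy_cvgP/cauchy_ballP => e e0; near_simpl.
  apply: filterS (Fc e e0) => -[x y] /=.
  by apply: le_lt_trans; exact: (entry_le_space_norm i (x - y)).
pose l : label -> R^o := fun i => lim ((fun x : blockSpace => x i : R) @ F).
have entry_lim i d : 0 < d ->
    \forall x \near F, `|(x : blockSpace) i - l i| <= d.
  by move=> d0; have /cvgrPdistC_le := entry_cvg i; exact.
have lim_block e : 0 < e ->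
    \forall x \near F, forall k, block k (val (x : blockSpace) - l) <= e.
  move=> e0; have e4 : 0 < e / 4 by rewrite divr_gt0.
  have e2 : 0 < e / 2 by rewrite divr_gt0.
  have : \forall x \near F, \forall y \near F, `|(x : blockSpace) - y| <= e / 2.
    by apply: nearP_dep; apply: filterS (Fc _ e2) => -[x y] /ltW.
  apply: filterS => x Fx k; near F => y.
  have -> : val x - l = (val x - val y) + (val y - l).
    by rewrite addrA subrK.
  apply: le_trans (ler_blockD _ _ _) _.
  have xy : block k (val x - val y) <= e / 2.
    apply: le_trans (block_le_space_norm k (x - y)) _; near: y; exact: Fx.
  have yk : `|y (Some k) - l (Some k)| <= e / 4 by near: y; exact: entry_lim.
  have yN : `|y None - l None| <= e / 4 by near: y; exact: entry_lim.
  have kyN : k.1%:R * `|y None - l None| <= e / 4.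
    by apply: le_trans yN; rewrite ler_piMl// lern1 leq_b1.
  by rewrite /block in xy *; lra.
have l_bounded : l \in bounded_blocks.
  have [x xl] := filter_ex (lim_block 1 ltr01).
  (* This difference is [l], and both of its terms have bounded blocks. *)
  have : val x - (val x - l) \in bounded_blocks.
    rewrite rpredB ?entry_bounded//; apply/bounded_blocksP.
    by exists 1.
  by rewrite subKr.
apply/cvg_ex; exists (BlockSpace l l_bounded).
apply/cvgrPdistC_le => e /lim_block; apply: filterS => x xl.
exact/space_norm_leP.
Unshelve. all: by end_near. Qed.

HB.instance Definition _ := Uniform_isComplete.Build blockSpace space_complete.

End Space.
Arguments blockSpace R : clear implicits.

(** Some point of the ball brings [|f|] close to its supremum 1; that point or its opposite lies in
    the slice. *)
Lemma slice_nonempty {R : realType} {Z : completeNormedModType R} (f : dual Z)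
    (alpha : R) :
  dual_unit_sphere Z f -> 0 < alpha -> slice f alpha !=set0.
Proof.
pose E := [set `|sval f z| | z in unit_ball Z].
rewrite -[dual_unit_sphere Z f]/(sup E = 1) => f1 a0.
have hE : has_sup E.
  (* Without a supremum, [sup E] would take its default value 0, not 1. *)
  apply: contrapT => /sup_out; rewrite f1 => /eqP.
  by rewrite oner_eq0.
have [_ [z z1 <-]] := sup_adherent a0 hE; rewrite f1.
case: ger0P => _ z_large; first by exists z.
by exists (- z); split; rewrite ?linearN//= /unit_ball/= normrN.
Qed.

(** * Unit vectors and their weak convergence to 0 *)

Section Delta.
Context {R : realType}.
Implicit Types (x : blockSpace R) (k : bool * nat).

Let delta_fun (i : label) : label -> R^o := fun j => (j == i)%:R.

Let delta_bounded i : delta_fun i \in bounded_blocks.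
Proof.
apply/bounded_blocksP; exists (1 + 1) => k; rewrite /block/delta_fun !normr_nat.
by rewrite -natrM -natrD -(natrD _ 1 1) ler_nat leq_add ?leq_b1// mulnb leq_b1.
Qed.

Definition delta i : blockSpace R := BlockSpace (delta_fun i) (delta_bounded i).

Lemma deltaE i j : delta i j = (j == i)%:R. Proof. by []. Qed.

Lemma space_norm_le1 x : (forall k, block k x <= 1) -> `|x| <= 1.
Proof. by move=> x1; apply/space_norm_leP. Qed.

Lemma block_le_norm k x : block k x <= `|x|.
Proof. exact: block_le_space_norm. Qed.

Lemma entry_le_norm i x : `|x i| <= `|x|.
Proof. exact: entry_le_space_norm. Qed.

Lemma entryD x y i : (x + y) i = x i + y i. Proof. by []. Qed.

Lemma entryZ a x i : (a *: x) i = a * x i. Proof. by []. Qed.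

Lemma entry_sum T (r : seq T) (P : pred T) (F : T -> blockSpace R) i :
  (\sum_(t <- r | P t) F t) i = \sum_(t <- r | P t) F t i.
Proof. by elim/big_rec2: _ => [//|t y x _ <-]. Qed.

(** For a perturbed point of the ball, this leaves a single block to check. *)
Lemma block_add_delta k j c x : block j (x + c *: delta (Some k)) =
  if j == k then `|x (Some k) + c| + k.1%:R * `|x None| else block j x.
Proof.
rewrite /block !entryD !entryZ !deltaE mulr0 addr0.
by rewrite (inj_eq Some_inj); case: eqP => [->|_]; rewrite ?mulr1 ?mulr0 ?addr0.
Qed.

(** The summands have disjoint supports and no R-coordinate, so each block sees at most one of
    them. *)
Lemma norm_sum_delta_le1 b N (s : nat -> R) : (forall n, `|s n| <= 1) ->
  `|\sum_(n < N) s n *: delta (Some (b, nat_of_ord n))| <= 1.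
Proof.
move=> s1; apply: space_norm_le1 => -[c m].
rewrite /block !entry_sum [X in _ + _ * `|X|]big1 => [|n _]; last first.
  by rewrite entryZ mulr0.
rewrite normr0 mulr0 addr0.
have [bc|bc] := eqVneq c b; last first.
  rewrite big1 ?normr0// => n _.
  rewrite entryZ deltaE (inj_eq Some_inj) xpair_eqE.
  by rewrite (negPf bc) mulr0.
have [mN|Nm] := ltnP m N; last first.
  rewrite big1 ?normr0// => n _.
  rewrite entryZ deltaE (inj_eq Some_inj) xpair_eqE.
  by rewrite gtn_eqF ?andbF ?mulr0// (leq_trans _ Nm).
rewrite (bigD1 (Ordinal mN))// big1 => [|n nm].
  by rewrite Monoid.mulm1 entryZ deltaE bc eqxx mulr1.
rewrite entryZ deltaE (inj_eq Some_inj) xpair_eqE eq_sym -val_eqE/= in nm *.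
by rewrite (negPf nm) andbF mulr0.
Qed.

(* By [norm_sum_delta_le1], applied to the signs of [f (delta (Some (b, n)))],
   the series of the absolute values of these numbers is bounded. *)
Lemma dual_delta_cvg0 (f : dual (blockSpace R)) b :
  sval f (delta (Some (b, n))) @[n --> \oo] --> (0 : R^o).
Proof.
apply/norm_cvg0P; apply: cvg_series_cvg_0.
have /linear_bounded_continuous/linear_boundedP := svalP f.
move=> /pinfty_ex_gt0[K K0 fK].
apply: nondecreasing_is_cvgn.
  by apply: nondecreasing_series => n _ _; exact: normr_ge0.
exists K => _ [N _ <-]; rewrite /series/= big_mkord.
pose s n := Num.sg (sval f (delta (Some (b, n)))).
rewrite (_ : \sum_(_ < N) _ =
    sval f (\sum_(n < N) s n *: delta (Some (b, nat_of_ord n)))); last first.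
  rewrite linear_sum; apply: eq_bigr => n _; rewrite linearZ/=.
  by rewrite normrEsg.
apply: le_trans (ler_norm _) _; apply: le_trans (fK _) _.
rewrite ler_piMr ?(ltW K0)//; apply: norm_sum_delta_le1 => n.
by rewrite /s normr_sg; case: eqP => _; rewrite ?ler01 ?lexx.
Qed.

(** * Infinite dimension and property (P3) *)

Lemma space_infinite_dimensional : infinite_dimensional (blockSpace R).
Proof.
move=> n v; apply: contrapT => /forallNP span.
have {}span (z : blockSpace R) :
    exists a : 'I_n -> R, z = \sum_(i < n) a i *: v i.
  by have /existsNP[a /contrapT] := span z; exists a.
have /choice[a aP] (j : 'I_n.+1) := span (delta (Some (true, nat_of_ord j))).
(* If [n] vectors spanned, coefficients times entries would factor the identity of size [n.+1]
   through dimension [n]. *)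
pose A := \matrix_(j < n.+1, i < n) a j i.
pose B := \matrix_(i < n, j < n.+1) v i (Some (true, nat_of_ord j)).
suff /mulmx1_min : A *m B = 1%:M by rewrite ltnn.
apply/matrixP => j l; rewrite !mxE.
transitivity (delta (Some (true, nat_of_ord j)) (Some (true, nat_of_ord l))).
  by rewrite aP entry_sum; apply: eq_bigr => i _; rewrite !mxE.
by rewrite deltaE (inj_eq Some_inj) xpair_eqE eqxx/= val_eqE eq_sym.
Qed.

Lemma space_P3 : P3 (blockSpace R).
Proof.
move=> _ [n [lambda [S [lambda0 lambda1 S_slice ->]]]].
have /choice[f] := S_slice => /choice[alpha fP].
have /choice[s sP] i : exists s, slice (f i) (alpha i) s.
  by have [f1 alpha0 _] := fP i; exact: slice_nonempty.
have /filter_ex[m mP] : \forall m \near \oo, forall i : 'I_n,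
    1 - alpha i < sval (f i) (s i) +
      (1 - s i (Some (false, m))) * sval (f i) (delta (Some (false, m))).
  apply: filter_forall => i; have [si1 si] := sP i.
  (* Half the margin of [s i] in its slice: the factor [1 - s i (Some (false, m))] is at most 2 in
     absolute value. *)
  pose d : R := (sval (f i) (s i) - (1 - alpha i)) / 2.
  have d0 : 0 < d by rewrite divr_gt0// subr_gt0.
  have /cvgrPdistC_lt/(_ _ d0) := dual_delta_cvg0 (f i) false.
  apply: filterS => m; rewrite subr0 => fm.
  have c2 : `|1 - s i (Some (false, m))| <= 2.
    apply: le_trans (ler_normB _ _) _; rewrite normr1 (natrD _ 1 1) lerD2l.
    exact: le_trans (entry_le_norm _ _) si1.
  have : `|(1 - s i (Some (false, m))) * sval (f i) (delta (Some (false, m)))|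
      < 2 * d.
    rewrite normrM; apply: le_lt_trans (ler_wpM2r _ c2) _ => //.
    by rewrite ltr_pM2l.
  by rewrite /d ltr_norml => /andP[+ _]; lra.
pose k := (false, m).
(* The entry at [k] becomes 1. As the flag of [k] is [false], the R-coordinate does not count in
   this block, which is then exactly 1. *)
pose t i := s i + (1 - s i (Some k)) *: delta (Some k).
have t1 i : `|t i| <= 1.
  apply: space_norm_le1 => j; rewrite block_add_delta; case: eqP => _.
    by rewrite mul0r addr0 addrC subrK normr1.
  by apply: le_trans (block_le_norm _ _) _; have [] := sP i.
exists (\sum_(i < n) lambda i *: t i); split.
  exists t => // i; have [_ _ ->] := fP i; split; first exact: t1.
  by rewrite linearD linearZ; exact: mP.
apply/eqP; rewrite eq_le; apply/andP; split.
  apply: le_trans (ler_norm_sum _ _ _) _; rewrite -lambda1 ler_sum// => i _.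
  by rewrite normrZ ger0_norm// ler_piMr.
apply: le_trans (entry_le_norm (Some k) _).
rewrite entry_sum (eq_bigr lambda) ?lambda1 ?normr1// => i _.
by rewrite entryZ entryD entryZ deltaE eqxx mulr1 addrC subrK mulr1.
Qed.

(** * Failure of (P2) *)

Definition scaled_axis (c : R) (x : blockSpace R) : R^o := c * x None.

Lemma scaled_axis_linear c : linear (scaled_axis c).
Proof.
move=> a x y; rewrite /scaled_axis entryD entryZ mulrDr /GRing.scale/=; ring.
Qed.

HB.instance Definition _ c :=
  GRing.isLinear.Build R (blockSpace R) R^o _
    (scaled_axis c) (scaled_axis_linear c).

Lemma scaled_axis_continuous c : continuous (scaled_axis c).
Proof.
apply/linear_bounded_continuous/linear_boundedP.
near=> r => x; rewrite normrM; apply: ler_pM => //; last exact: entry_le_norm.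
Unshelve. all: by end_near. Qed.

Definition axis_dual c : dual (blockSpace R) :=
  exist _ (scaled_axis c : {linear blockSpace R -> R^o})
    (scaled_axis_continuous c).

Lemma axis_dual_unit c :
  `|c| = 1 -> dual_unit_sphere (blockSpace R) (axis_dual c).
Proof.
move=> c1; have ub : ubound [set `|sval (axis_dual c) z| | z in unit_ball _] 1.
  move=> _ [z z1 <-] /=; rewrite normrM c1 mul1r.
  exact: le_trans (entry_le_norm _ _) z1.
(* The functional attains its norm at [delta None]. *)
have dN : unit_ball (blockSpace R) (delta None).
  by apply: space_norm_le1 => -[[] n]; rewrite /block !deltaE normr0 add0r
    ?mul1r ?normr1 ?mul0r ?ler01.
have v1 : [set `|sval (axis_dual c) z| | z in unit_ball _] 1.
  by exists (delta None); rewrite //= normrM c1 mul1r normr1.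
apply/eqP; rewrite eq_le; apply/andP; split.
  by apply: ge_sup => //; exists 1.
by apply: ub_le_sup => //; exists 1.
Qed.

Lemma cvg_weak {Z : completeNormedModType R} (u : nat -> Z) (z : Z) :
  (forall f : dual Z, sval f (u n) @[n --> \oo] --> (sval f z : R^o)) ->
  u @ \oo --> (z : weak Z).
Proof.
move=> fu; apply/cvg_sup => f A [_ [[B oB <-] Bz] BA].
apply: filterS BA _; apply: (fu f); exact: open_nbhs_nbhs.
Qed.

Lemma add_delta_cvg_weak x c b :
  x + c *: delta (Some (b, n)) @[n --> \oo] --> (x : weak (blockSpace R)).
Proof.
apply: cvg_weak => f.
rewrite (_ : (fun n => _) =
    fun n => sval f x + c * sval f (delta (Some (b, n)))); last first.
  by apply/funext => n; rewrite linearD linearZ.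
suff : sval f x + c * sval f (delta (Some (b, n))) @[n --> \oo] -->
    (sval f x + c * 0 : R^o) by rewrite mulr0 addr0.
by apply: cvgD; [exact: cvg_cst|apply: cvgMl_tmp; exact: dual_delta_cvg0].
Qed.

Lemma space_not_P2 : ~ P2 (blockSpace R).
Proof.
pose sign (i : 'I_2) : R := (-1) ^+ i.
pose S i := slice (axis_dual (sign i)) (1 / 8).
pose C := [set \sum_(i < 2) (1 / 2 : R) *: s i
  | s in [set s : 'I_2 -> blockSpace R | forall i, S i (s i)]].
(* The two R-coordinates lie beyond 7/8 with opposite signs, so they nearly cancel in the average;
   each leaves less than 1/8 for the second copy of l^oo. *)
have C_small z : C z -> `|z None| <= 1 / 8 /\
    forall n, `|z (Some (true, n))| <= 1 / 8.
  move=> [s sS <-]; have [s0 +] := sS ord0; have [s1 +] := sS ord_max.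
  rewrite /= /scaled_axis /sign expr0 expr1 mul1r mulN1r => sN1 sN0.
  have sumE i : (\sum_(j < 2) (1 / 2 : R) *: s j) i =
      1 / 2 * s ord0 i + 1 / 2 * s ord_max i.
    rewrite entry_sum big_ord_recl big_ord1 !entryZ.
    by rewrite (_ : lift ord0 ord0 = ord_max)//; exact/val_inj.
  have b0 n := le_trans (block_le_norm (true, n) (s ord0)) s0.
  have b1 n := le_trans (block_le_norm (true, n) (s ord_max)) s1.
  split=> [|n].
    have := le_trans (entry_le_norm None (s ord0)) s0.
    have := le_trans (entry_le_norm None (s ord_max)) s1.
    by rewrite sumE !ler_norml => /andP[? ?] /andP[? ?]; apply/andP; split; lra.
  have := b0 n; have := b1 n; rewrite sumE /block !mul1r.
  have := ler_norm (s ord0 None); have := ler_norm (- s ord_max None).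
  rewrite normrN => ? ? ? ?; apply: le_trans (ler_normD _ _) _.
  by rewrite !normrM ger0_norm; lra.
move=> /(_ C)[].
  exists 2%N, (fun=> 1 / 2), S; split=> [i||i|//].
  - by rewrite divr_ge0.
  - by rewrite big_ord_recl big_ord1; lra.
  exists (axis_dual (sign i)), (1 / 8); split=> //.
  by apply: axis_dual_unit; rewrite normrX normrN1 expr1n.
(* [W] is weakly open, contains [z], and its trace on the ball lies in [C]. *)
move=> z [_ [[W oW <-] Wz]] WC.
have Cz : C (set_val z) by exact: WC.
pose x : blockSpace R := set_val z.
have [zN zS] : `|x None| <= 1 / 8 /\ forall n, `|x (Some (true, n))| <= 1 / 8.
  exact: C_small.
have zW : nbhs (set_val z : weak (blockSpace R)) W by exact: open_nbhs_nbhs.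
(* The step 1/2 keeps the changed block at most 1/8 + 1/2 + 1/8 <= 1, yet forces an entry of at
   least 1/2 - 1/8 > 1/8, against [C_small]. *)
pose u n := x + (1 / 2) *: delta (Some (true, n)).
have /filter_ex[n] : \forall n \near \oo, W (u n).
  exact: (add_delta_cvg_weak x (1 / 2) true).
set w := u n => Ww.
have w1 : unit_ball (blockSpace R) w.
  apply: space_norm_le1 => j; rewrite block_add_delta; case: eqP => _.
    have := ler_normD (x (Some (true, n))) (1 / 2); have := zS n.
    rewrite (@ger0_norm _ (1 / 2))// !mul1r; move: zN; lra.
  by apply: le_trans (block_le_norm _ _) _; exact: (set_valP z).
have Cw : C w by exact: (WC (exist _ w (mem_set w1) : weak_unit_ball _) Ww).
have [_ /(_ n)] := C_small _ Cw.
have := zS n; rewrite /w entryD entryZ deltaE eqxx mulr1 !ler_norml; lra.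
Qed.

End Delta.

Theorem corollary2p9 (R : realType) :
  exists Z : completeNormedModType R,
    [/\ infinite_dimensional Z, P3 Z & ~ P2 Z].
Proof.
exists (blockSpace R); split.
- exact: space_infinite_dimensional.
- exact: space_P3.
- exact: space_not_P2.
Qed.
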